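(* For arbitrarily large $n$, there exist polytopal 3-complexes $Q$ such that $f_0(Q), f_3(Q)\le n$ and $f_{03}(Q)=\Theta(n\alpha(n))$ (i.e. there are absolute constants $0<c<C$ such that for arbitrarily large $n$ such a $Q$ exists with $cn\alpha(n)\le f_{03}(Q)\le Cn\alpha(n)$).
   Context: A polytopal 3-complex is a collection $Q$ of (convex) polytopes in $\mathbb{R}^3$ containing the empty set, closed under taking faces, and such that any two members intersect in a (possibly empty) common face of both. $f_k(Q)$ is the number of $k$-dimensional members of $Q$, and $f_{03}(Q)$ is the number of pairs (vertex, 3-dimensional member) with the vertex contained in the 3-dimensional member. Ackermann function: $A(1,t)=2t$, $A(s,1)=2$, $A(s,t)=A(s-1,A(s,t-1))$ for $s,t>1$; $\alpha(n)=\min\{s: A(s,s)\ge n\}$. *)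

(* Defs.v *)
From HB Require Import structures.
From mathcomp Require Import all_boot all_order all_algebra.
From mathcomp Require Import finmap boolp classical_sets cardinality reals convex.

Set Implicit Arguments.
Unset Strict Implicit.
Unset Printing Implicit Defensive.

Import Order.TTheory GRing.Theory Num.Theory.

Local Open Scope classical_set_scope.
Local Open Scope ring_scope.

Section Polytopes.
Context {R : realType} {d : nat}.
Local Notation point := 'rV[R]_d.
Implicit Types (A F P : set point) (Q : set (set point)).

Definition convex_hull A : set point := smallest (@convex_set R point) A.

Definition is_polytope P := exists2 A, finite_set A & P = convex_hull A.

(* A face of P is cut out by an inequality x *m a <= b valid on P; taking
   a = 0 with b = 0 or b = 1 yields the improper faces P and set0. *)
Definition is_face F P := exists (a : 'cV[R]_d) (b : R),
  (forall x, P x -> (x *m a) 0 0 <= b) /\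
  F = P `&` [set x | (x *m a) 0 0 = b].

Definition flat (x : point) (U : {vspace point}) : set point :=
  [set y | y - x \in U].

Definition affine_hull A : set point :=
  smallest [set L | exists x U, L = flat x U] A.

(* The empty set, of conventional dimension -1, satisfies has_dim k for no k. *)
Definition has_dim (k : nat) P := exists (x : point) (U : {vspace point}),
  affine_hull P = flat x U /\ \dim U = k.

Record polytopal_complex Q : Prop := PolytopalComplex {
  complex_finite : finite_set Q;
  complex_polytope : forall P, Q P -> is_polytope P;
  complex_empty : Q set0;
  complex_face : forall P F, Q P -> is_face F P -> Q F;
  complex_meet : forall P P', Q P -> Q P' ->
    is_face (P `&` P') P /\ is_face (P `&` P') P'
}.

(* fset_set is meaningful only on finite sets, whence complex_finite. *)
Definition fnum (k : nat) Q : nat := #|` fset_set [set P | Q P /\ has_dim k P]|.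

(* Vertices are the 0-dimensional members, i.e. singletons. *)
Definition fnum03 Q : nat :=
  #|` fset_set [set VP : set point * set point |
       [/\ Q VP.1 /\ has_dim 0 VP.1, Q VP.2 /\ has_dim 3 VP.2
         & VP.1 `<=` VP.2]]|.

End Polytopes.

Local Open Scope nat_scope.

(* Only arguments s, t >= 1 are meaningful; the values at 0 are junk. *)
Fixpoint ack (s : nat) : nat -> nat :=
  match s with
  | 0 => fun _ => 0
  | s'.+1 =>
      if s' is 0 then fun t => 2 * t
      else fix ack_s t :=
        match t with
        | 0 => 0
        | t'.+1 => if t' is 0 then 2 else ack s' (ack_s t')
        end
  end.

Lemma ack1 t : ack 1 t = 2 * t.
Proof. by []. Qed.

Lemma ackn1 s : 1 < s -> ack s 1 = 2.
Proof. by case: s => [|[|s]]. Qed.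

Lemma ack_rec s t : 1 < s -> 1 < t -> ack s t = ack s.-1 (ack s t.-1).
Proof. by case: s => [|[|s]] //; case: t => [|[|t]]. Qed.

Lemma ltn_ack s t : 0 < s -> 0 < t -> t < ack s t.
Proof.
elim: s t => // -[_ t _ t0|s IHs t _]; first by rewrite ack1 ltn_Pmull.
elim: t => // -[_ _|t IHt _]; first by rewrite ackn1.
rewrite ack_rec //=; have lt_t := IHt isT.
apply: leq_trans (IHs (ack s.+2 t.+1) isT _); last exact: leq_trans lt_t.
by rewrite ltnS; exact: lt_t.
Qed.

Lemma ack_diag_ge n : exists s, (0 < s) && (n <= ack s s).
Proof. by exists n.+1; rewrite (leq_trans _ (ltn_ack _ _)) // leqW // leqW. Qed.

Definition inv_ack (n : nat) : nat := ex_minn (ack_diag_ge n).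

(* Main.v *)
(** Lift a planar point (x, y) to (x, x^2, y) in R^3 and give it the height y^2.
An axis-parallel ellipse with no given point inside then becomes an affine
function lying below all the heights, with equality exactly at the points on the
ellipse.  Lower faces of a lifted point set always meet in common faces, so it
suffices to find about n points and n empty axis-parallel ellipses with many
incidences; the points on an ellipse, at least five in number, span R^3.

Given such a system, replace each point v by its k translates v + (T t_a, g s_a),
where the (t_a, s_a) lie on the unit circle, T is huge and g is tiny.  The k
translates of an old ellipse remain empty because T is huge, and the very flat
ellipse centred at v with radii T and g contains no other point because g is
tiny; it passes through all translates of v.  Each step multiplies the number of
points by k and puts every point on one more ellipse, so k steps from m points
yield m k^k points and as many ellipses, with k points each.  Taking n = A(k, k)
and m = n / k^k makes k = alpha(n). *)

Require Import Defs.
From mathcomp Require Import all_boot all_order all_algebra.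
From mathcomp Require Import finmap boolp classical_sets cardinality reals.
From mathcomp Require Import interval_inference convex.
From mathcomp Require Import ring lra.

Set Implicit Arguments.
Unset Strict Implicit.
Unset Printing Implicit Defensive.

Import Order.TTheory GRing.Theory Num.Theory.
Local Open Scope classical_set_scope.
Local Open Scope ring_scope.

(** * Uniform bounds and cardinalities over finite types *)

(** Supplies every sufficiently large or small constant below: [M] exceeds the sum of all the ratios
    [|v k| / u k]. *)
Lemma exists_large (R : realFieldType) (K : finType) (u v : K -> R) :
  (forall k, 0 < u k) -> exists2 M, 0 < M & forall k, v k < M * u k.
Proof.
move=> u0; exists (1 + \sum_k `|v k| / u k) => [|k].
  by rewrite ltr_pwDl// sumr_ge0// => k _; rewrite divr_ge0// ltW.
rewrite -ltr_pdivrMr// (@le_lt_trans _ _ (`|v k| / u k))//.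
  by rewrite ler_wpM2r ?ler_norm// invr_ge0 ltW.
rewrite [in ltRHS](bigD1 k)//= addrCA ltrDl ltr_pwDl//.
by apply: sumr_ge0 => j _; rewrite divr_ge0// ltW.
Qed.

Lemma leq_fset_set_image (K : finType) (T : choiceType) (f : K -> T) (A : set T) :
  A `<=` range f -> (#|` fset_set A| <= #|K|)%N.
Proof.
move=> Af; have fin : finite_set (range f) by exact: finite_image.
rewrite (leq_trans (fsubset_leq_card (_ : fset_set A `<=` [fset f k | k : K])%fset)) //.
  apply/fsubsetP => x; rewrite in_fset_set ?inE; last exact: sub_finite_set fin.
  by move=> /Af[k _ <-]; apply/imfsetP; exists k.
by rewrite (leq_trans (leq_imfset_card _ _ _))// -cardE.
Qed.

Lemma card_fset_set_image (K : finType) (T : choiceType) (f : K -> T) (D : {pred K}) :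
  injective f -> #|` fset_set (f @` [set` D])| = #|D|.
Proof.
move=> f_inj; have fin : finite_set (f @` [set` D]) by apply: finite_image; exact: finite_finset.
suff -> : fset_set (f @` [set` D]) = [fset f k | k in D]%fset by rewrite card_imfset//= cardE.
apply/fsetP => x; rewrite in_fset_set//; apply/idP/imfsetP => [/set_mem[k Dk <-]|[k Dk ->]].
  by exists k.
by apply/mem_set; exists k.
Qed.

(** * Convex sets and convex combinations *)

Section ConvexCombinations.
Context {R : realType} {V : lmodType R}.

Lemma convex_setP (A : set V) : @convex_set R V A <->
  forall x y (a b : R), 0 <= a -> 0 <= b -> a + b = 1 -> A x -> A y ->
    A (a *: x + b *: y).
Proof.
split=> [cA x y a b a0 b0 ab Ax Ay|cA x y l /set_mem Ax /set_mem Ay].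
  have a1 : a <= 1 by rewrite -ab lerDl.
  have /set_mem := cA x y (Itv01 a0 a1) (mem_set Ax) (mem_set Ay).
  have -> : b = 1 - a by rewrite -ab addrAC subrr add0r.
  by [].
apply/mem_set; apply: cA => //; first by rewrite /unstable.onem subr_ge0.
by rewrite /unstable.onem subrKC.
Qed.

(** Dividing by the total weight, instead of requiring it to be 1, lets the induction on [r] go
    through; only a tail of total weight 0 has to be treated apart. *)
Lemma convex_sum (A : set V) (I : eqType) (r : seq I) (p : I -> V) (l : I -> R) :
  @convex_set R V A -> (forall i, 0 <= l i) -> (forall i, l i != 0 -> A (p i)) ->
  0 < \sum_(i <- r) l i ->
  A ((\sum_(i <- r) l i)^-1 *: \sum_(i <- r) l i *: p i).
Proof.
move=> /convex_setP cA l0 Ap; elim: r => [|i r IHr]; first by rewrite big_nil ltxx.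
rewrite !big_cons; set s := \sum_(j <- r) l j; set y := \sum_(j <- r) _.
have s0 : 0 <= s by apply: sumr_ge0.
have [li0|li0] := eqVneq (l i) 0; first by rewrite li0 scale0r !add0r.
move=> tot; have [s_eq0|s_neq0] := eqVneq s 0.
  have -> : y = 0.
    apply: big1_seq => j /= jr; move: s_eq0 => /eqP.
    rewrite psumr_eq0// => /allP /(_ j jr) /= /eqP ->; exact: scale0r.
  by rewrite s_eq0 !addr0 scalerA mulVf// scale1r; exact: Ap.
rewrite scalerDr scalerA -[y](@scalerKV _ _ s)// scalerA.
apply: cA; [by rewrite mulr_ge0// invr_ge0 ltW|by rewrite mulr_ge0// invr_ge0 ltW| |exact: Ap|].
  by rewrite -mulrDr mulVf// gt_eqF.
by apply: IHr; rewrite lt_neqAle eq_sym s_neq0.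
Qed.

End ConvexCombinations.

(** * Hulls of finite point families and lower faces of a lifting *)

Section FiniteHull.
Context {R : realType} {d : nat} {I : finType}.
Variable p : I -> 'rV[R]_d.
Implicit Types (S T : {set I}) (l : I -> R).

(** Coefficients live on all of [I] and vanish off [S], so that combinations over different subsets
    can be compared directly. *)
Definition weights S l :=
  [/\ forall i, 0 <= l i, forall i, i \notin S -> l i = 0 & \sum_i l i = 1].

Definition hull S : set 'rV[R]_d := convex_hull (p @` [set` S]).

Lemma hullP S x : hull S x <-> exists2 l, weights S l & x = \sum_i l i *: p i.
Proof.
split=> [|[l [l0 lS l1] ->] A [cA pA]]; last first.
  have := @convex_sum _ _ A I (index_enum I) p l cA l0.
  rewrite l1 invr1 scale1r; apply=> // i li; apply: pA; exists i => //=.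
  by apply: contraNT li => iS; rewrite lS.
move: x; apply: (@smallest_sub _ _ _
    [set x | exists2 l, weights S l & x = \sum_i l i *: p i]) => [|y [i /= iS <-]].
  apply/convex_setP => y z a b a0 b0 ab [l [l0 lS l1] ->] [k [k0 kS k1] ->].
  exists (fun i => a * l i + b * k i).
    split=> [i|i iS|]; first by rewrite addr_ge0// mulr_ge0.
      by rewrite lS// kS// !mulr0 addr0.
    by rewrite big_split/= -!mulr_sumr l1 k1 !mulr1.
  by rewrite !scaler_sumr -big_split/=; apply: eq_bigr => i _; rewrite scalerDl !scalerA.
exists (fun j => (j == i)%:R).
  split=> [j|j jS|]; first by rewrite ler0n.
    by case: eqP jS => // ->; rewrite iS.
  by rewrite (bigD1 i)//= eqxx big1 ?addr0// => j /negPf->.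
by rewrite (bigD1 i)//= eqxx scale1r big1 ?addr0// => j /negPf->; rewrite scale0r.
Qed.

Lemma sub_hull S i : i \in S -> hull S (p i).
Proof. by move=> iS; apply: sub_gen_smallest; exists i. Qed.

Lemma hullS S T : S \subset T -> hull S `<=` hull T.
Proof.
move=> /fintype.subsetP ST x /hullP[l [l0 lS l1] ->]; apply/hullP; exists l => //.
by split=> // i iT; apply: lS; apply: contra iT; exact: ST.
Qed.

Lemma hull0 : hull finset.set0 = set0.
Proof.
apply/seteqP; split=> // x /hullP[l [_ l0 l1] _]; move: l1.
by rewrite big1 => [/esym/eqP|i _]; [rewrite oner_eq0|rewrite l0// finset.in_set0].
Qed.

Lemma hull1 i : hull [set i]%SET = [set p i].
Proof.
apply/seteqP; split=> [x /hullP[l [_ l0 l1] ->]|x ->]; last by apply: sub_hull; rewrite finset.in_set1.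
have lj j : j != i -> l j = 0 by move=> ji; rewrite l0// finset.in_set1.
rewrite (bigD1 i)//= big1 ?addr0 in l1 => [|j /lj//].
by rewrite /= (bigD1 i)//= l1 scale1r big1 ?addr0// => j /lj->; rewrite scale0r.
Qed.

Lemma hull_polytope S : is_polytope (hull S).
Proof. by exists (p @` [set` S]) => //; exact: finite_image. Qed.

Definition aff (a : 'cV[R]_d) (b : R) (x : 'rV[R]_d) : R := (x *m a) 0 0 + b.

Lemma aff_sum a b S l : weights S l ->
  aff a b (\sum_i l i *: p i) = \sum_i l i * aff a b (p i).
Proof.
move=> [_ _ l1]; rewrite /aff mulmx_suml summxE.
under [RHS]eq_bigr do rewrite mulrDr.
rewrite big_split/= -mulr_suml l1 mul1r; congr (_ + _).
by apply: eq_bigr => i _; rewrite -scalemxAl mxE.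
Qed.

Lemma affB a b a' b' x : aff (a - a') (b - b') x = aff a b x - aff a' b' x.
Proof. by rewrite /aff mulmxBr !mxE opprD addrACA. Qed.

Lemma affZ k a b x : aff (k *: a) (k * b) x = k * aff a b x.
Proof. by rewrite /aff -scalemxAr mxE mulrDr. Qed.

Lemma affD a b a' b' x : aff (a + a') (b + b') x = aff a b x + aff a' b' x.
Proof. by rewrite /aff mulmxDr !mxE addrACA. Qed.

Variable h : I -> R.

(* [S] spans a lower face of the convex hull of the lifted points [(p i, h i)]. *)
Definition exposed S := exists a b, forall i,
  if i \in S then aff a b (p i) = h i else aff a b (p i) < h i.

Lemma exposed_le S a b :
  (forall i, if i \in S then aff a b (p i) = h i else aff a b (p i) < h i) ->
  forall i, aff a b (p i) <= h i.
Proof. by move=> aS i; have := aS i; case: ifP => _; [move->|move/ltW]. Qed.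

(** At [x] the function supporting [T] interpolates the heights over [T], hence is at least the one
    supporting [S]. A point of positive weight outside [T] would make it strictly smaller, by the
    expansion of [x] over [S]. *)
Lemma exposed_support S T l x : exposed S -> exposed T -> weights S l ->
  x = \sum_i l i *: p i -> hull T x -> forall i, l i != 0 -> i \in T.
Proof.
move=> [a [b aS]] [c [e cT]] wl xl /hullP[m wm xm] i li; apply: contraT => iT.
have [l0 lS l1] := wl; have [m0 mT m1] := wm.
have leS := exposed_le aS; have leT := exposed_le cT.
have ge : aff a b x <= aff c e x.
  rewrite xm !(aff_sum _ _ wm); apply: ler_sum => j _.
  have [jT|/mT->] := boolP (j \in T); last by rewrite !mul0r.
  by have := cT j; rewrite jT => ->; rewrite ler_wpM2l.
suff : aff c e x < aff a b x by rewrite ltNge ge.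
rewrite xl !(aff_sum _ _ wl) (bigD1 i)//= [ltRHS](bigD1 i)//=.
have iS : i \in S by apply: contraNT li => /lS->.
have := aS i; rewrite iS => ->; have := cT i; rewrite (negPf iT) => lti.
apply: ltr_leD; first by rewrite ltr_pM2l// lt_neqAle eq_sym li l0.
apply: ler_sum => j _; have [jS|/lS->] := boolP (j \in S); last by rewrite !mul0r.
by have := aS j; rewrite jS => ->; rewrite ler_wpM2l.
Qed.

Lemma hull_meet S T : exposed S -> exposed T ->
  hull S `&` hull T = hull (S :&: T)%SET.
Proof.
move=> eS eT; apply/seteqP; split=> [x [/hullP[l wl xl] Tx]|x STx]; last first.
  by split; apply: hullS STx; [exact: finset.subsetIl|exact: finset.subsetIr].
apply/hullP; exists l => //; have [l0 lS l1] := wl; split=> // i iST.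
apply: contraNeq iST => li; rewrite inE (exposed_support eS eT wl xl Tx li) andbT.
by apply: contraNT li => /lS->.
Qed.

Lemma hull_subset S T : exposed S -> exposed T ->
  hull S `<=` hull T -> S \subset T.
Proof.
move=> eS eT ST; apply/fintype.subsetP => i iS.
have iT := ST _ (sub_hull iS).
apply: (@exposed_support S T (fun j => (j == i)%:R) (p i)) => //; last first.
- by rewrite eqxx oner_eq0.
- by rewrite (bigD1 i)//= eqxx scale1r big1 ?addr0// => j /negPf->; rewrite scale0r.
split=> [j|j jS|]; first by rewrite ler0n.
  by case: eqP jS => // ->; rewrite iS.
by rewrite (bigD1 i)//= eqxx big1 ?addr0// => j /negPf->.
Qed.

Lemma hull_inj S T : exposed S -> exposed T -> hull S = hull T -> S = T.
Proof.
by move=> eS eT e; apply/eqP; rewrite finset.eqEsubset; apply/andP; split;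
  apply: hull_subset => //; rewrite e.
Qed.

(** A sum of nonpositive terms vanishes only if each term does, so the weight sits on the zeros of
    the function. *)
Lemma hull_face S a b : (forall i, i \in S -> aff a b (p i) <= 0) ->
  hull S `&` [set x | aff a b x = 0] = hull [set i in S | aff a b (p i) == 0]%SET.
Proof.
move=> aS; apply/seteqP; split=> [x [/hullP[l wl ->] /= ax]|x /hullP[l wl xl]].
  have [l0 lS l1] := wl.
  have /eqP : \sum_i l i * - aff a b (p i) = 0.
    by under eq_bigr do rewrite mulrN; rewrite sumrN -(aff_sum _ _ wl) ax oppr0.
  rewrite psumr_eq0 => [/allP eq0|i _]; last first.
    have [iS|/lS->] := boolP (i \in S); last by rewrite mul0r.
    by rewrite mulr_ge0// oppr_ge0 aS.
  apply/hullP; exists l => //; split=> // i; rewrite inE negb_and.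
  case/orP=> [/lS//|ai]; have := eq0 i (mem_index_enum i).
  by rewrite /= mulf_eq0 oppr_eq0 (negPf ai) orbF => /eqP.
have [l0 lS l1] := wl; split=> /=.
  rewrite xl; apply/hullP; exists l => //; split=> // i iS; apply: lS.
  by rewrite inE (negPf iS).
rewrite xl (aff_sum _ _ wl) big1// => i _.
have [|/lS->] := boolP (i \in [set i in S | aff a b (p i) == 0]%SET); last by rewrite mul0r.
by rewrite inE => /andP[_ /eqP->]; rewrite mulr0.
Qed.

(** The supporting function of [T] minus that of [S] is nonpositive on [S] and vanishes there
    exactly on the common points, so it cuts out the intersection. *)
Lemma exposedI_face S T : exposed S -> exposed T -> is_face (hull S `&` hull T) (hull S).
Proof.
move=> eS eT; rewrite (hull_meet eS eT).
have [a [b aS]] := eS; have [c [e cT]] := eT.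
have leT := exposed_le cT.
have neg i : i \in S -> aff (c - a) (e - b) (p i) <= 0.
  by move=> iS; have := aS i; rewrite iS affB => ->; rewrite subr_le0.
have -> : (S :&: T)%SET = [set i in S | aff (c - a) (e - b) (p i) == 0]%SET.
  apply/finset.setP => i; rewrite !inE; case iS : (i \in S) => //=.
  have := aS i; rewrite iS affB => ->; rewrite subr_eq0.
  by have := cT i; case: ifP => _; [move=> ->; rewrite eqxx|move/lt_eqF].
exists (c - a), (b - e); rewrite -(hull_face neg); split=> [x /hullP[l wl ->]|].
  have : aff (c - a) (e - b) (\sum_i l i *: p i) <= 0.
    have [l0 lS l1] := wl; rewrite (aff_sum _ _ wl); apply: sumr_le0 => i _.
    have [iS|/lS->] := boolP (i \in S); last by rewrite mul0r.
    by rewrite mulr_ge0_le0// neg.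
  by rewrite /aff -[e - b]opprB subr_le0.
by congr (_ `&` _); apply/funext => x /=; rewrite /aff; apply/propext; split=> ?; lra.
Qed.

(** Tilting the supporting function of [S] by a small positive multiple of the function [g] that
    defines the face keeps equality only where [g] vanishes on [S]. *)
Lemma exposed_face S F : exposed S -> is_face F (hull S) ->
  exists2 T, exposed T & T \subset S /\ F = hull T.
Proof.
move=> [a [b aS]] [c [e [valid ->]]].
pose g := aff c (- e).
have gS i : i \in S -> g (p i) <= 0.
  by move=> iS; rewrite /g /aff subr_le0; apply: valid; exact: sub_hull.
pose T := [set i in S | g (p i) == 0]%SET.
(* Off [S] the gap to the height is positive and must dominate [g / M]; the value 1 on [S] is a mere
   placeholder. *)
have [M M0 MP] := @exists_large R I
  (fun i => if i \in S then 1 else h i - aff a b (p i)) (fun i => g (p i))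
  ltac:(by move=> i; have := aS i; case: ifP => // _; rewrite subr_gt0).
exists T.
  exists (a + M^-1 *: c), (b + M^-1 * - e) => i.
  rewrite affD affZ -/g !inE; have := aS i; have := MP i.
  case: ifP => iS /= MPi aSi.
    rewrite aSi; case: ifP => [/eqP->|gi]; first by rewrite mulr0 addr0.
    by rewrite gtrDl pmulr_rlt0 ?invr_gt0// lt_neqAle gi gS.
  by rewrite -ltrBrDl mulrC ltr_pdivrMr// mulrC.
split; first by apply/fintype.subsetP => i; rewrite inE => /andP[].
rewrite -(hull_face gS); congr (_ `&` _); apply/funext => x /=.
by apply/propext; rewrite /g /aff; split=> ?; lra.
Qed.

End FiniteHull.

(** * Affine hulls and dimension *)

Section Dimension.
Context {R : realType} {d : nat}.
Implicit Types (P : set 'rV[R]_d) (x y : 'rV[R]_d).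

Lemma affine_hull_sub P x (U : {vspace 'rV[R]_d}) :
  P `<=` flat x U -> affine_hull P `<=` flat x U.
Proof. by move=> PU; apply: smallest_sub => //; exists x, U. Qed.

Lemma flat0 x : flat x 0%VS = [set x].
Proof.
apply/seteqP; split=> [y|_ ->]; last by rewrite /flat /= subrr mem0v.
by rewrite /flat /= memv0 subr_eq0 => /eqP.
Qed.

Lemma has_dim0_set1 x : has_dim 0 [set x].
Proof.
exists x, 0%VS; split; last exact: dimv0.
by rewrite flat0; apply: smallest_id; exists x, 0%VS; rewrite flat0.
Qed.

Lemma has_dim0_eq P x y : has_dim 0 P -> P x -> P y -> x = y.
Proof.
move=> [z [U [hPU /eqP]]]; rewrite dimv_eq0 => /eqP U0; subst U => Px Py.
have in1 w : P w -> w = z.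
  move=> Pw; have : affine_hull P w by apply: sub_gen_smallest.
  by rewrite hPU flat0.
by rewrite (in1 x Px) (in1 y Py).
Qed.

Lemma aff_flat (a : 'cV[R]_d) b x : aff a b x = 0 ->
  [set y | aff a b y = 0] = flat x (lker (linfun (mulmxr a : 'rV_d -> 'rV_1))).
Proof.
rewrite /aff => ax; apply/seteqP; split=> y; rewrite /flat /= memv_ker lfunE /= mulmxBl.
  move=> ay; rewrite subr_eq0; apply/eqP/rowP => i; rewrite ord1.
  exact: (addIr b (etrans ay (esym ax))).
by rewrite subr_eq0 => /eqP->.
Qed.

Lemma has_dim_full_aff P (a : 'cV[R]_d) b y : P !=set0 ->
  (forall x, P x -> aff a b x = 0) -> has_dim d P -> aff a b y = 0.
Proof.
move=> [x Px] Pab [z [U [hPU dU]]].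
have UT : U = fullv by apply/eqP; rewrite eqEdim subvf dU dimvf /dim /= mul1n leqnn.
have : affine_hull P y by rewrite hPU UT /flat /= memvf.
have eF := aff_flat (Pab x Px).
suff PF : P `<=` flat x (lker (linfun (mulmxr a : 'rV_d -> 'rV_1))).
  by move=> /(affine_hull_sub PF); rewrite -eF.
by rewrite -eF => w; exact: Pab.
Qed.

(** If a flat of direction [U] contains [P], each coordinate of [u - projv U u] is a linear form
    constant on [P], hence zero; so [U] is the whole space. *)
Lemma has_dim_full P : P !=set0 ->
  (forall (a : 'cV[R]_d) b, (forall x, P x -> aff a b x = 0) -> a = 0) -> has_dim d P.
Proof.
move=> [x0 Px0] nondeg; exists 0, fullv; split; last by rewrite dimvf /dim /= mul1n.
apply/seteqP; split=> [y _|y _]; first by rewrite /flat /= memvf.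
move=> L [[x [U ->]] PU]; suff -> : U = fullv by rewrite /flat /= memvf.
pose f : 'End('rV[R]_d) := (\1 - projv U)%VF.
have fE u : f u = u - projv U u by rewrite add_lfunE opp_lfunE id_lfunE.
have colf w k : (w *m col k (lin1_mx f)) 0 0 = f w 0 k.
  by rewrite -mul_rV_lin1 !mxE; apply: eq_bigr => j _; rewrite mxE.
have M0 : lin1_mx f = 0.
  apply/matrixP => i k; rewrite [RHS]mxE.
  suff -> : lin1_mx f i k = col k (lin1_mx f) i 0.
    rewrite (nondeg (col k (lin1_mx f)) (- f x 0 k)) ?mxE// => z Pz.
    suff e : f z = f x by rewrite /aff colf e subrr.
    suff : f (z - x) = 0 by rewrite linearB => /eqP; rewrite subr_eq0 => /eqP.
    by rewrite fE projv_id ?subrr//; exact: PU.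
  by rewrite [RHS]mxE.
apply/vspaceP => u; rewrite memvf.
have : f u = 0 by rewrite -mul_rV_lin1 M0 mulmx0.
by rewrite fE => /eqP; rewrite subr_eq0 => /eqP->; exact: memv_proj.
Qed.
End Dimension.

(** * The complex of lower faces and its face numbers *)

Section RegularComplex.
Context {R : realType} {d : nat} {I J : finType}.
Variables (p : I -> 'rV[R]_d) (h : I -> R) (F : J -> {set I}).
Hypothesis F_exposed : forall j, exposed p h (F j).
Hypothesis pt_exposed : forall i, exposed p h [set i]%SET.
Hypothesis F_inj : injective F.
Hypothesis F_neq0 : forall j, F j != finset.set0.
Hypothesis F_full : forall j (a : 'cV[R]_d) b,
  (forall i, i \in F j -> aff a b (p i) = 0) -> a = 0.
Hypothesis d_gt0 : (0 < d)%N.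

(** Only faces of the chosen cells are kept. The separate case of the empty subset covers an empty
    family [J]. *)
Definition lower_complex : set (set 'rV[R]_d) :=
  [set P | exists2 S, exposed p h S /\ (S = finset.set0 \/ exists j, S \subset F j)
                    & P = hull p S].

Lemma set0_exposed : exposed p h finset.set0.
Proof.
have [M _ hM] := @exists_large R I (fun=> 1) (fun i => - h i) (fun=> ltr01).
exists 0, (- M) => i; rewrite finset.in_set0 /aff mulmx0 mxE add0r.
by have := hM i; rewrite mulr1 ltrNl.
Qed.

Lemma lower_complexP : polytopal_complex lower_complex.
Proof.
split.
- apply: (@sub_finite_set _ _ (range (hull p))).
    by move=> P [S _ ->]; exact: imageT.
  exact: finite_image.
- by move=> P [S _ ->]; exact: hull_polytope.
- exists finset.set0; last by rewrite hull0.
  by split; [exact: set0_exposed|left].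
- move=> P G [S [eS Sj] ->] /(exposed_face eS)[T eT [TS ->]].
  exists T => //; split=> //; case: Sj => [S0|[j Sj]].
    by left; move: TS; rewrite S0 finset.subset0 => /eqP.
  by right; exists j; exact: fintype.subset_trans Sj.
move=> P P' [S [eS _] ->] [T [eT _] ->]; split; first by apply: (@exposedI_face R d I p h).
by rewrite setIC; apply: (@exposedI_face R d I p h).
Qed.

Lemma hull_neq0 S : (hull p S !=set0) -> S != finset.set0.
Proof. by move=> [x Sx]; apply/eqP => S0; move: Sx; rewrite S0 hull0. Qed.

(** The affine hull of the empty set lies in every singleton, whereas a flat contains its base
    point; for [0 < d] there are two distinct points. *)
Lemma has_dim_neq0 k (P : set 'rV[R]_d) : has_dim k P -> P !=set0.
Proof.
move=> [x [U [hPU _]]]; apply: contrapT => /set0P/negP/negPn/eqP P0; subst P.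
have in0 y : affine_hull (@set0 'rV[R]_d) `<=` [set y].
  by rewrite -flat0; apply: affine_hull_sub.
have xin : affine_hull (@set0 'rV[R]_d) x by rewrite hPU /flat /= subrr mem0v.
have eqx y : x = y by exact: (in0 y x xin).
move: (eqx (x + const_mx 1)) => /(congr1 (fun u : 'rV_d => u 0 (Ordinal d_gt0))); rewrite !mxE => /eqP.
by rewrite -subr_eq0 opprD addrA subrr sub0r oppr_eq0 oner_eq0.
Qed.

Lemma lower_complex_dim0 P : lower_complex P -> has_dim 0 P -> exists i, P = [set p i].
Proof.
move=> [S _ ->] P0; have /hull_neq0/finset.set0Pn[i iS] := has_dim_neq0 P0.
exists i; apply/seteqP; split=> [x Sx|_ ->]; last exact: sub_hull.
by rewrite (has_dim0_eq P0 Sx (sub_hull iS)).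
Qed.

(** The supporting functions of [S] and of the cell containing it agree on [S]. If [S] spans the
    space they agree everywhere, so [S] is the whole cell. *)
Lemma lower_complex_full P : lower_complex P -> has_dim d P -> exists j, P = hull p (F j).
Proof.
move=> [S [eS Sj] ->] Sd; have S0 := has_dim_neq0 Sd.
case: Sj => [Se|[j Sj]]; first by have := hull_neq0 S0; rewrite Se eqxx.
exists j; congr hull; apply/eqP; rewrite finset.eqEsubset Sj /=.
apply/fintype.subsetP => i iF; apply: contraT => iS.
have [a [b aS]] := eS; have [c [e cF]] := F_exposed j.
have : aff (a - c) (b - e) (p i) = 0.
  apply: has_dim_full_aff S0 _ Sd => x /hullP[l wl ->].
  rewrite (aff_sum _ _ _ wl) big1// => k _; have [_ lS _] := wl.
  have [kS|/lS->] := boolP (k \in S); last by rewrite mul0r.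
  have := aS k; have := cF k; rewrite kS (fintype.subsetP Sj _ kS) affB => -> ->.
  by rewrite subrr mulr0.
have := aS i; have := cF i; rewrite iF (negPf iS) affB => -> lti /eqP.
by rewrite subr_eq0 lt_eqF.
Qed.

Lemma lower_complex_cell j : lower_complex (hull p (F j)) /\ has_dim d (hull p (F j)).
Proof.
split; first by exists (F j) => //; split=> //; right; exists j.
have /finset.set0Pn[i iF] := F_neq0 j.
apply: has_dim_full => [|a b ab0]; first by exists (p i); exact: sub_hull.
by apply: (F_full (j := j) (b := b)) => k kF; apply: ab0; exact: sub_hull.
Qed.

Lemma lower_complex_vertex i j : i \in F j ->
  lower_complex [set p i] /\ has_dim 0 [set p i].
Proof.
move=> iF; split; last exact: has_dim0_set1.
exists [set i]%SET; last by rewrite hull1.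
by split=> //; right; exists j; rewrite finset.sub1set.
Qed.

Lemma sub_set1_hull i j : [set p i] `<=` hull p (F j) -> i \in F j.
Proof.
rewrite -hull1 => /(hull_subset (pt_exposed i) (F_exposed j)).
by rewrite finset.sub1set.
Qed.

Lemma fnum0_lower_complex : (fnum 0 lower_complex <= #|I|)%N.
Proof.
apply: (@leq_fset_set_image _ _ (fun i => [set p i])) => P [QP /(lower_complex_dim0 QP)[i ->]].
by exists i.
Qed.

Lemma fnum_lower_complex : (fnum d lower_complex <= #|J|)%N.
Proof.
apply: (@leq_fset_set_image _ _ (fun j => hull p (F j))) => P [QP /(lower_complex_full QP)[j ->]].
by exists j.
Qed.

Lemma pt_inj : injective p.
Proof.
move=> i k e; apply/finset.set1_inj.
by apply: (hull_inj (pt_exposed _) (pt_exposed _)); rewrite !hull1 e.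
Qed.

(** Vertices and cells determine their index sets, so the pairs correspond bijectively to the
    incidences between [I] and [J]. *)
Lemma card_vertex_cell_pairs :
  #|` fset_set [set VP : set 'rV[R]_d * set 'rV[R]_d |
       [/\ lower_complex VP.1 /\ has_dim 0 VP.1, lower_complex VP.2 /\ has_dim d VP.2
         & VP.1 `<=` VP.2]]| = (\sum_j #|F j|)%N.
Proof.
pose f (ji : J * I) := ([set p ji.2], hull p (F ji.1)).
have f_inj : injective f.
  move=> [j i] [j' i'] [/= e1 e2]; congr pair.
    by apply: F_inj; exact: hull_inj e2.
  by apply: pt_inj; have : [set p i] (p i) by []; rewrite e1.
pose D := [pred ji : J * I | ji.2 \in F ji.1].
transitivity #|D|; last first.
  rewrite -sum1_card; under [RHS]eq_bigr do rewrite -sum1_card.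
  by rewrite pair_big_dep.
rewrite -(card_fset_set_image D f_inj); congr #|` fset_set _|.
apply/seteqP; split=> [[V P] /= [[QV V0] [QP Pd] VP]|_ [[j i] /= iF <-]].
  have [i Vi] := lower_complex_dim0 QV V0; have [j Pj] := lower_complex_full QP Pd.
  subst V P; exists (j, i) => //=; exact: sub_set1_hull.
split=> /=; [exact: lower_complex_vertex iF|exact: lower_complex_cell|].
by move=> _ ->; exact: sub_hull.
Qed.

End RegularComplex.

(** * Systems of points and empty axis-parallel ellipses *)

Section EmptyEllipses.
Context {R : realType}.

(* The ellipse [j] has centre [(cabs j, cord j)] and half-axes [rad1 j], [rad2 j]. *)
Record empty_ellipses (k : nat) := EmptyEllipses {
  point : finType;
  ellipse : finType;
  abs : point -> R;
  ord : point -> R;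
  cabs : ellipse -> R;
  cord : ellipse -> R;
  rad1 : ellipse -> R;
  rad2 : ellipse -> R;
  on : ellipse -> {set point};
  ord_inj : injective ord;
  on_inj : injective on;
  rad1_gt0 : forall j, 0 < rad1 j;
  rad2_gt0 : forall j, 0 < rad2 j;
  onP : forall j i,
    let D := ((abs i - cabs j) / rad1 j) ^+ 2 + ((ord i - cord j) / rad2 j) ^+ 2 in
    if i \in on j then D = 1 else 1 < D;
  card_on : forall j, #|on j| = k;
  on_full : forall j (a b c e : R),
    (forall i, i \in on j -> a * abs i + b * abs i ^+ 2 + c * ord i + e = 0) ->
    [/\ a = 0, b = 0 & c = 0]
}.

Section Step.
Variables (k : nat) (t s : 'I_k -> R).
Hypothesis k_ge5 : (4 < k)%N.
Hypothesis circle : forall a, t a ^+ 2 + s a ^+ 2 = 1.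
Hypothesis t_inj : injective t.
Hypothesis s_inj : injective s.

(** Eliminating [s] through [s^2 = 1 - t^2] gives a polynomial of degree at most 4 in [t] with at
    least five distinct roots, hence zero. Its leading coefficient [b^2] kills [b]; its quadratic
    one then reads [a^2 + c^2]. *)
Lemma circle_full (a b c e : R) :
  (forall i, a * t i + b * t i ^+ 2 + c * s i + e = 0) -> [/\ a = 0, b = 0 & c = 0].
Proof.
move=> abc.
pose P : {poly R} := (b *: 'X^2 + a *: 'X + e%:P) ^+ 2 - c ^+ 2 *: (1 - 'X^2).
(* The coefficients of [P], constant term first. *)
pose L := [:: e ^+ 2 - c ^+ 2; 2 * a * e; a ^+ 2 + 2 * b * e + c ^+ 2; 2 * a * b; b ^+ 2].
have PL : P = Poly L.
  rewrite /P /= !cons_poly_def mul0r add0r -!mul_polyC !(polyCD, polyCM, polyCN, polyC_exp).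
  by rewrite !polyC1; ring.
have L0 : Poly L = 0.
  apply: (@roots_geq_poly_eq0 _ _ [seq t i | i <- enum 'I_k]).
  - apply/allP => _ /mapP[i _ ->]; rewrite -PL /root /P !hornerE.
    have -> : c ^+ 2 * (1 - t i ^+ 2) = (c * s i) ^+ 2 by rewrite -(circle i); ring.
    have -> : c * s i = - (a * t i + b * t i ^+ 2 + e) by have := abc i; lra.
    by apply/eqP => /=; ring.
  - by rewrite map_inj_uniq ?enum_uniq.
  - by rewrite size_map size_enum_ord (leq_trans (size_Poly _)).
have co n : (Poly L)`_n = L`_n by rewrite coef_Poly.
have b0 : b = 0.
  by apply/eqP; have := co 4; rewrite L0 coef0 /= => /esym/eqP; rewrite expf_eq0.
have ac0 : a ^+ 2 + c ^+ 2 = 0.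
  by have := co 2; rewrite L0 coef0 /= b0 => /esym; rewrite mulr0 mul0r addr0.
by split=> //; apply/eqP; have /eqP := ac0;
  rewrite paddr_eq0 ?sqr_ge0// !sqrf_eq0 => /andP[].
Qed.

Lemma circle_s_le1 a : `|s a| <= 1.
Proof.
by rewrite -(@ler_pXn2r _ 2)// ?nnegrE// expr1n real_normK ?num_real// -(circle a) lerDr sqr_ge0.
Qed.

Lemma sqr_gt1 (u v : R) : 0 < v -> v < `|u| -> 1 < (u / v) ^+ 2.
Proof.
move=> v0 vu; rewrite -[X in _ < X]real_normK ?num_real// normrM normfV (gtr0_norm v0).
by rewrite exprn_egt1// ltr_pdivlMr// mul1r.
Qed.

Lemma add_circle (E : empty_ellipses k) : exists E' : empty_ellipses k,
  #|point E'| = (#|point E| * k)%N /\ #|ellipse E'| = (#|ellipse E| * k + #|point E|)%N.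
Proof.
case: E => I J x y p q r w F y_inj F_inj r0 w0 FP Fk F_full /=.
(* [T] makes copies with different circle indices so far apart horizontally that no copied point
   comes within [r j] of the centre of an ellipse copied with another index. *)
have [T T0 TP] : exists2 T, 0 < T & forall j i a b, a != b ->
    `|x i - p j| + r j < T * `|t b - t a|.
  have [|T T0 TP] := @exists_large R (J * I * 'I_k * 'I_k)%type
    (fun u => if u.1.2 != u.2 then `|t u.2 - t u.1.2| else 1)
    (fun u => `|x u.1.1.2 - p u.1.1.1| + r u.1.1.1).
    by move=> [[[j i] a] b] /=; case: ifP => // ab; rewrite normr_gt0 subr_eq0
      (inj_eq t_inj) eq_sym.
  by exists T => // j i a b ab; have /= := TP (j, i, a, b); rewrite ab.
(* Vertical shifts are at most [g]. The factor 2 keeps new ordinates distinct and lifts copies of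
   other points out of a flat ellipse of half-height [g]. *)
have [g g0 gP] : exists2 g, 0 < g & forall i i', i != i' -> 2 * g < `|y i' - y i|.
  have [|M M0 MP] := @exists_large R (I * I)%type
    (fun u => if u.1 != u.2 then `|y u.2 - y u.1| else 1) (fun=> 2).
    by move=> [i i'] /=; case: ifP => // ii; rewrite normr_gt0 subr_eq0 (inj_eq y_inj) eq_sym.
  exists M^-1 => [|i i' ii]; first by rewrite invr_gt0.
  by have /= := MP (i, i'); rewrite ii -ltr_pdivrMl// mulrC.
pose I' := (I * 'I_k)%type; pose J' := (J * 'I_k + I)%type.
pose x' (u : I') := x u.1 + T * t u.2; pose y' (u : I') := y u.1 + g * s u.2.
(* [inl (j, a)] is the copy of ellipse [j] with index [a]; [inr i] is the flat ellipse around the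
   old point [i]. *)
pose p' (v : J') := match v with inl ja => p ja.1 + T * t ja.2 | inr i => x i end.
pose q' (v : J') := match v with inl ja => q ja.1 + g * s ja.2 | inr i => y i end.
pose r' (v : J') := match v with inl ja => r ja.1 | inr i => T end.
pose w' (v : J') := match v with inl ja => w ja.1 | inr i => g end.
pose F' (v : J') : {set I'} := match v with
  | inl ja => finset.setX (F ja.1) [set ja.2]%SET
  | inr i => finset.setX [set i]%SET [set: 'I_k]%SET end.
have k0 : (0 < k)%N by exact: leq_trans k_ge5.
have y'_inj : injective y'.
  move=> [i a] [i' b]; rewrite /y' /= => e.
  have [ii|ii] := eqVneq i i'.
    subst i'; congr pair; apply: s_inj; apply: (mulfI (lt0r_neq0 g0)); exact: addrI e.
  have := gP _ _ ii; suff : `|y i' - y i| <= 2 * g by move=> /le_lt_trans h /h; rewrite ltxx.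
  have -> : y i' - y i = g * (s a - s b) by lra.
  rewrite normrM (gtr0_norm g0) mulrC ler_pM2r//.
  by rewrite (le_trans (ler_normB _ _))// (le_trans (lerD (circle_s_le1 a) (circle_s_le1 b))).
have F'_inj : injective F'.
  have in0 j : exists i, i \in F j by apply/finset.set0Pn; rewrite -card_gt0 Fk.
  pose a0 := Ordinal k0; pose a1 : 'I_k := Ordinal (leq_trans (isT : 1 < 5)%N k_ge5).
  (* A copied ellipse meets a single circle index, a flat one meets both [a0] and [a1]. *)
  have neq j a i : F' (inl (j, a)) != F' (inr i).
    apply/eqP => /finset.setP e; have := e (i, a0); have := e (i, a1).
    rewrite !inE /= eqxx /= => /andP[_ /eqP <-] /andP[_].
    by [].
  move=> [[j a]|i] [[j' b]|i'] e.
  - have [i ij] := in0 j; have [i' ij'] := in0 j'.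
    have ab : a = b.
      by have := congr1 (fun A : {set I'} => (i, a) \in A) e;
        rewrite !inE /= ij eqxx /= => /esym/andP[_ /eqP].
    congr inl; congr pair => //; apply: F_inj; apply/finset.setP => l.
    have := congr1 (fun A : {set I'} => (l, a) \in A) e.
    by rewrite !inE /= ab eqxx !andbT.
  - by have := neq j a i'; rewrite e eqxx.
  - by have := neq j' b i; rewrite e eqxx.
  congr inr; have := congr1 (fun A : {set I'} => (i, a0) \in A) e.
  by rewrite !inE /= eqxx !andbT => /esym/eqP.
have F'P v u : let D := ((x' u - p' v) / r' v) ^+ 2 + ((y' u - q' v) / w' v) ^+ 2 in
    if u \in F' v then D = 1 else 1 < D.
  case: u => i b; case: v => [[j a]|i']; rewrite /= !inE /x' /y' /=.
    have [<-|ab] := eqVneq b a.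
      rewrite andbT; have := FP j i => /=.
      by rewrite /= !opprD ![_ + _ + (- _ - _)]addrACA !subrr !addr0.
    (* For different indices the horizontal term alone exceeds 1. *)
    rewrite andbF ltr_wpDr ?sqr_ge0// sqr_gt1//.
    have := TP j i a b; rewrite eq_sym ab => /(_ isT) Tab.
    have -> : x i + T * t b - (p j + T * t a) = T * (t b - t a) - (p j - x i) by ring.
    apply: lt_le_trans (lerB_dist _ _); rewrite normrM (gtr0_norm T0) ltrBrDl.
    by rewrite distrC.
  rewrite andbT; have [->|ii] := eqVneq i i'.
    rewrite ![_ + _ * _ - _]addrAC !subrr !add0r ![_ * _ / _]mulrAC.
    by rewrite !divff ?gt_eqF// !mul1r circle.
  (* For copies of another point the vertical term alone exceeds 1. *)
  rewrite ltr_wpDl ?sqr_ge0// sqr_gt1//.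
  have := gP _ _ ii; rewrite distrC => gii.
  have -> : y i + g * s b - y i' = (y i - y i') - - (g * s b) by ring.
  apply: lt_le_trans (lerB_dist _ _); rewrite normrN normrM (gtr0_norm g0).
  have := circle_s_le1 b; rewrite -(ler_pM2l g0) mulr1; lra.
have F'k v : #|F' v| = k.
  case: v => [[j a]|i] /=; first by rewrite cardsX Fk cards1 muln1.
  by rewrite cardsX cards1 cardsT card_ord mul1n.
have F'_full v a b c e :
    (forall u, u \in F' v -> a * x' u + b * x' u ^+ 2 + c * y' u + e = 0) ->
    [/\ a = 0, b = 0 & c = 0].
  case: v => [[j o]|i] /= abc.
    (* Expanding the square of the shifted abscissa turns the relation into one among the old
       points. *)
    have [|+ b0 c0] := F_full j (a + 2 * b * (T * t o)) b c
      (a * (T * t o) + b * (T * t o) ^+ 2 + c * (g * s o) + e).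
      move=> i iF; have := abc (i, o); rewrite !inE /= iF eqxx => /(_ isT) <-.
      by rewrite /x' /y' /=; ring.
    by rewrite b0 mulr0 mul0r addr0.
  (* Around the fixed point [i] the relation is one among the circle points, with rescaled
     coefficients. *)
  have [|+ /eqP + /eqP] := @circle_full (a * T + 2 * b * x i * T) (b * T ^+ 2) (c * g)
      (a * x i + b * x i ^+ 2 + c * y i + e).
    move=> o; have := abc (i, o); rewrite !inE /= eqxx => /(_ isT) <-.
    by rewrite /x' /y' /=; ring.
  rewrite !mulf_eq0 !(gt_eqF T0, gt_eqF g0) !orbF => + /eqP b0 /eqP c0.
  by rewrite b0 mulr0 !mul0r addr0 => /eqP; rewrite mulf_eq0 (gt_eqF T0) orbF => /eqP.
have r'0 v : 0 < r' v by case: v => [ja|i] /=.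
have w'0 v : 0 < w' v by case: v => [ja|i] /=.
exists (EmptyEllipses y'_inj F'_inj r'0 w'0 F'P F'k F'_full) => /=.
by rewrite card_sum !card_prod card_ord.
Qed.

End Step.

(** With [t a = a / k] all points lie in one closed quadrant, where either coordinate determines the
    other. *)
Lemma exists_circle_points k : exists t s : 'I_k -> R,
  [/\ forall a, t a ^+ 2 + s a ^+ 2 = 1, injective t & injective s].
Proof.
pose t (a : 'I_k) : R := a%:R / k%:R.
have k0 (a : 'I_k) : 0 < k%:R :> R by rewrite ltr0n (leq_ltn_trans _ (ltn_ord a)).
have t0 a : 0 <= t a by rewrite divr_ge0.
have t1 a : t a ^+ 2 <= 1.
  by rewrite exprn_ile1// ler_pdivrMr ?k0// mul1r ler_nat ltnW.
have t_inj : injective t.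
  move=> a b /(congr1 (fun z => z * k%:R)); rewrite !divfK ?gt_eqF ?(k0 a)//.
  by move=> /eqP; rewrite eqr_nat => /eqP/val_inj.
pose s a := Num.sqrt (1 - t a ^+ 2).
have s2 a : s a ^+ 2 = 1 - t a ^+ 2 by rewrite sqr_sqrtr// subr_ge0.
exists t, s; split=> [a||a b] //; first by rewrite s2 addrC subrK.
move=> /(congr1 (fun z => z ^+ 2)); rewrite !s2 => /addrI/oppr_inj/eqP.
by rewrite eqrXn2// => /eqP/t_inj.
Qed.

(** Start from [m] points on a vertical line and no ellipse, then apply [add_circle] [d] times. The
    second equation counts incidences: each step puts every point on one more ellipse. *)
Lemma exists_empty_ellipses k m d : (4 < k)%N -> exists E : empty_ellipses k,
  #|point E| = (m * k ^ d)%N /\ (#|ellipse E| * k = d * #|point E|)%N.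
Proof.
move=> k5; have [t [s [circle t_inj s_inj]]] := exists_circle_points k.
elim: d => [|d [E [Ep Ee]]].
  have y_inj : injective (fun i : 'I_m => i%:R : R).
    by move=> i i' /eqP; rewrite eqr_nat => /eqP/val_inj.
  pose z (j : void) : R := match j with end.
  unshelve eexists (@EmptyEllipses k 'I_m void (fun=> 0) (fun i => i%:R) z z z z
    (fun j => match j with end) y_inj _ _ _ _ _ _); try by case.
  by rewrite /= card_ord card_void expn0 muln1.
have [E' [E'p E'e]] := add_circle k5 circle t_inj s_inj E; exists E'.
rewrite E'p E'e; split; first by rewrite Ep expnSr mulnA.
by rewrite mulnDl Ee -mulnA mulSn addnC.
Qed.

End EmptyEllipses.

(** * From empty ellipses to a polytopal complex in dimension three *)

Section LiftedComplex.
Context {R : realType} {k : nat} (E : empty_ellipses (R := R) k).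

Definition lifted (i : point E) : 'rV[R]_3 :=
  \row_l [:: abs i; abs i ^+ 2; ord i]`_l.

Definition col3 (a b c : R) : 'cV[R]_3 := \col_l [:: a; b; c]`_l.

Lemma aff_lift (a : 'cV[R]_3) e i : aff a e (lifted i) =
  a 0 0 * abs i + a 1 0 * abs i ^+ 2 + a 2 0 * ord i + e.
Proof.
rewrite /aff mxE !big_ord_recl big_ord0 !mxE /= addr0 addrA.
rewrite (_ : lift _ _ = 1)//; last exact: val_inj.
rewrite (_ : lift _ _ = 2)//; last exact: val_inj.
by rewrite ![_ * a _ _]mulrC.
Qed.

(** The function comes from solving the equation of the ellipse for the squared ordinate; height
    minus function is [rad2 j ^+ 2 * (D - 1)]. *)
Lemma on_exposed j : exposed lifted (fun i => ord i ^+ 2) (on j).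
Proof.
pose u := (rad2 j / rad1 j) ^+ 2.
exists (col3 (2 * u * cabs j) (- u) (2 * cord j)),
  (rad2 j ^+ 2 - cord j ^+ 2 - u * cabs j ^+ 2) => i.
rewrite aff_lift !mxE /=.
have r0 := rad1_gt0 j; have w0 := rad2_gt0 j.
set G := _ + (_ - _ - _).
set D := ((abs i - cabs j) / rad1 j) ^+ 2 + ((ord i - cord j) / rad2 j) ^+ 2.
have DE : ord i ^+ 2 - G = rad2 j ^+ 2 * (D - 1).
  by rewrite /G /D /u; field; rewrite !gt_eqF.
have := onP j i; rewrite /= -/D; case: ifP => _ D1.
  by apply/esym/eqP; rewrite -subr_eq0 DE D1 subrr mulr0.
by rewrite -subr_gt0 DE mulr_gt0 ?exprn_gt0// subr_gt0.
Qed.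

(** A circle of radius 0: height minus function is the squared planar distance to the point [i]. *)
Lemma point_exposed i : exposed lifted (fun i => ord i ^+ 2) [set i]%SET.
Proof.
exists (col3 (2 * abs i) (- 1) (2 * ord i)), (- abs i ^+ 2 - ord i ^+ 2) => l.
rewrite aff_lift !mxE /= finset.in_set1; case: eqVneq => [->|li]; first by ring.
have yl : ord l - ord i != 0 by rewrite subr_eq0 (inj_eq (@ord_inj _ _ _)).
have : 0 < (ord l - ord i) ^+ 2 by rewrite lt_neqAle sqr_ge0 eq_sym sqrf_eq0 yl.
by have := sqr_ge0 (abs l - abs i); lra.
Qed.

Lemma on_affine_full j (a : 'cV[R]_3) b :
  (forall i, i \in on j -> aff a b (lifted i) = 0) -> a = 0.
Proof.
move=> ab0; have [|a0 a1 a2] := on_full (j := j) (a := a 0 0) (b := a 1 0) (c := a 2 0) (e := b).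
  by move=> i ij; rewrite -aff_lift ab0.
apply/matrixP => i l; rewrite ord1 mxE; case: i => [[|[|[|//]]] i3].
- by rewrite -[RHS]a0; congr (a _ _); exact: val_inj.
- by rewrite -[RHS]a1; congr (a _ _); exact: val_inj.
- by rewrite -[RHS]a2; congr (a _ _); exact: val_inj.
Qed.

Lemma ellipse_complex : (0 < k)%N -> exists Q : set (set 'rV[R]_3),
  [/\ polytopal_complex Q, (fnum 0 Q <= #|point E|)%N, (fnum 3 Q <= #|ellipse E|)%N
    & fnum03 Q = (#|ellipse E| * k)%N].
Proof.
move=> k0; exists (lower_complex lifted (fun i => ord i ^+ 2) (@on _ _ E)).
have on0 j : on j != finset.set0 :> {set point E} by rewrite -card_gt0 card_on.
split.
- exact: lower_complexP.
- exact: fnum0_lower_complex.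
- by apply: fnum_lower_complex => //; exact: on_exposed.
rewrite /fnum03 card_vertex_cell_pairs//.
- by under eq_bigr do rewrite card_on; rewrite sum_nat_const.
- exact: on_exposed.
- exact: point_exposed.
- exact: on_inj.
- exact: on_affine_full.
Qed.

End LiftedComplex.

(** * Monotonicity and growth of the Ackermann function *)

Section Ackermann.
Local Open Scope nat_scope.

Lemma ltn_ackS s t : 0 < s -> 0 < t -> ack s t < ack s t.+1.
Proof.
case: s => // -[|s] _ t0; first by rewrite !ack1 ltn_pmul2l.
by rewrite [ltnRHS]ack_rec//; apply: ltn_ack => //; exact: leq_ltn_trans (ltn_ack _ t0).
Qed.

Lemma leq_ack s t t' : 0 < s -> 0 < t -> t <= t' -> ack s t <= ack s t'.
Proof.
move=> s0 t0; elim: t' => [|t' IH]; first by rewrite leqn0; case: t t0.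
rewrite leq_eqVlt => /predU1P[->//|]; rewrite ltnS => tt.
by rewrite (leq_trans (IH tt))// ltnW// ltn_ackS// (leq_trans t0).
Qed.

Lemma leq_ackl s s' t : 0 < s -> s <= s' -> 0 < t -> ack s t <= ack s' t.
Proof.
move=> s0 ss' t0; elim: s' ss' => [|s' IH]; first by rewrite leqn0; case: s s0.
rewrite leq_eqVlt => /predU1P[->//|]; rewrite ltnS => ss'.
rewrite (leq_trans (IH ss'))//; have s'0 := leq_trans s0 ss'; case: t t0 {IH} => // -[_|t _].
  by case: s' s'0 {ss'} => // -[|s'] _; rewrite ?ack1 ?ackn1.
by rewrite [leqRHS]ack_rec//; apply: leq_ack => //; apply: ltn_ack.
Qed.

Lemma leq_ack_diag s s' : 0 < s -> s < s' -> ack s s < ack s' s'.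
Proof.
move=> s0 ss'; have s'0 := leq_trans s0 (ltnW ss').
apply: leq_trans (ltn_ackS s0 s0) _; apply: (leq_trans (leq_ack s0 _ ss')) => //.
by apply: leq_ackl => //; exact: ltnW.
Qed.

Lemma inv_ack_diag k : 0 < k -> inv_ack (ack k k) = k.
Proof.
move=> k0; rewrite /inv_ack; case: ex_minnP => s /andP[s0 ks] s_min.
apply/eqP; rewrite eqn_leq s_min ?k0 ?leqnn//= leqNgt; apply/negP => sk.
by move: ks; rewrite leqNgt leq_ack_diag.
Qed.

Lemma ack2 t : 0 < t -> ack 2 t = 2 ^ t.
Proof. by elim: t => // -[//|t] IHt _; rewrite ack_rec// IHt// ack1 [RHS]expnS. Qed.

(** Level 3 is a tower of twos. The case [t = 3] is the equality 16 = 16, and [2 ^ (t.+1 ^ 2)] is at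
    least [(2 ^ t.+1) ^ 2]. *)
Lemma leq_sqr_ack3 t : 2 < t -> t.+1 ^ 2 <= ack 3 t.
Proof.
elim: t => // t IHt; rewrite ltnS leq_eqVlt => /predU1P[<-//|t3].
have t0 : 0 < t by exact: leq_trans t3.
rewrite ack_rec// ack2; last exact: leq_trans (IHt t3).
rewrite (@leq_trans (2 ^ (t.+1 ^ 2)))//; last by rewrite leq_exp2l// IHt.
rewrite -[X in (_ <= 2 ^ X)%N]mulnn expnM (@leq_trans ((2 ^ t.+1) ^ 2))//.
  by rewrite leq_exp2r//; exact: ltn_expl.
by rewrite leq_pexp2l ?expn_gt0.
Qed.

(** Level 3 suffices: [ack 3 k] is at least [2 ^ (k ^ 2) = (2 ^ k) ^ k]. *)
Lemma leq_expn_ack k : 3 < k -> k ^ k <= ack k k.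
Proof.
case: k => // k k3; apply: (@leq_trans (ack 3 k.+1)); last by apply: leq_ackl => //; exact: ltnW.
have kk := leq_sqr_ack3 k3.
rewrite ack_rec//; last by rewrite (leq_trans _ k3).
rewrite ack2; last exact: leq_trans kk.
rewrite (@leq_trans (2 ^ (k.+1 ^ 2)))//; last by rewrite leq_exp2l.
by rewrite -[X in (_ <= 2 ^ X)%N]mulnn expnM leq_exp2r// ltnW// ltn_expl.
Qed.

End Ackermann.

(** * Choice of parameters and conclusion *)

Theorem mainTheorem2 (R : realType) :
  exists c C : R, [/\ 0 < c, c < C &
    forall N : nat, exists n : nat, (N <= n)%N /\
      exists Q : set (set 'rV[R]_3),
        [/\ polytopal_complex Q,
            (fnum 0 Q <= n)%N,
            (fnum 3 Q <= n)%N,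
            c * (n * inv_ack n)%:R <= (fnum03 Q)%:R
          & (fnum03 Q)%:R <= C * (n * inv_ack n)%:R]].
Proof.
(* There are [k] incidences per point and at most [n] points; rounding [n] down to a multiple of
   [k ^ k] loses at most half. *)
exists 2^-1, 1; split; [by rewrite invr_gt0|by rewrite invf_lt1// ltr1n|move=> N].
pose k := (N + 5)%N; have k0 : (0 < k)%N by rewrite addn_gt0 orbT.
have k5 : (4 < k)%N by rewrite leq_addl.
pose n := ack k k; exists n.
have kn : (k < n)%N by apply: ltn_ack.
have kkn : (k ^ k <= n)%N by apply: leq_expn_ack; exact: ltnW.
split; first by rewrite (leq_trans _ (ltnW kn))// leq_addr.
pose m := (n %/ k ^ k)%N.
(* Taking exactly [k] steps makes the numbers of points and ellipses equal. *)
have [E [Ep Ee]] := @exists_empty_ellipses R k m k k5.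
have kk0 : (0 < k ^ k)%N by rewrite expn_gt0 k0.
have eqE : #|ellipse E| = #|point E|.
  by apply/eqP; rewrite -(eqn_pmul2r k0) Ee mulnC.
have [Q [QP Q0 Q3 Q03]] := ellipse_complex E k0.
have mn : (#|point E| <= n)%N by rewrite Ep leq_divM.
exists Q; split=> //.
- exact: leq_trans Q0 mn.
- by rewrite eqE in Q3; exact: leq_trans Q3 mn.
- rewrite inv_ack_diag// Q03 eqE ler_pdivrMl// -natrM ler_nat mulnA leq_mul2r.
  apply/orP; right; rewrite Ep.
  have m0 : (0 < m)%N by rewrite divn_gt0.
  (* The remainder is less than [k ^ k], hence at most [m * k ^ k] since [m] is positive. *)
  rewrite {1}(divn_eq n (k ^ k)) -/m mul2n -addnn leq_add2l.
  by rewrite (leq_trans (ltnW (ltn_pmod _ kk0)))// leq_pmull.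
by rewrite inv_ack_diag// Q03 eqE mul1r ler_nat leq_mul2r mn orbT.
Qed.
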